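(* There exists a universal constant $C\ge 1$ such that the following holds. Let $f:\mathbb{R}^d\to\mathbb{R}$ be $L$-smooth and $\mu$-strongly convex, let $x^*$ be its unique minimizer, and let $\kappa=L/\mu>1$. Suppose the algorithm AQGD (defined in the context) is run on $f$ with step-size $\alpha=1/(6L)$ and contraction factor $\gamma=\sqrt{d}/2^b$, where the bit-precision $b$ per component satisfies $$b\ \ge\ C\log\left(\frac{d\kappa}{\kappa-1}\right).$$ Then for all $t\ge 0$, $$f(x_t)-f(x^* )\ \le\ \left(1-\frac{1}{12\kappa}\right)^t\left(f(x_0)-f(x^* )+\alpha R_0^2\right).$$
   Context: $\Vert\cdot\Vert$ is the Euclidean norm. A continuously differentiable $f:\mathbb{R}^d\to\mathbb{R}$ is $L$-smooth if $\Vert\nabla f(x)-\nabla f(y)\Vert\le L\Vert x-y\Vert$ for all $x,y\in\mathbb{R}^d$. A differentiable $f$ is $\mu$-strongly convex if $f(y)-f(x)\ge\langle y-x,\nabla f(x)\rangle+\frac{\mu}{2}\Vert y-x\Vert^2$ for all $x,y\in\mathbb{R}^d$. Here $L,\mu>0$. Scalar quantizer $\mathcal{Q}_{b,R}$ ($b$ a positive integer, $R\ge 0$): for $X\in\mathbb{R}^d$ with $\Vert X\Vert\le R$ (so each component $X_i\in[-R,R]$), partition $[-R,R]$ into $2^b$ bins of equal width and let $\tilde X_i$ be the center of the bin containing $X_i$; then $\mathcal{Q}_{b,R}(X)=\tilde X=[\tilde X_1,\dots,\tilde X_d]^\top$. Only the values of $\mathcal{Q}_{b,R}$ on $\{\Vert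 X\Vert\le R\}$ are specified. Algorithm AQGD, with step-size $\alpha>0$, contraction factor $\gamma$ and bit-precision $b$: initialize $x_0=0$, $g_{-1}=0$, and pick $R_0$ such that $\Vert\nabla f(x_0)\Vert\le R_0$. For $t=0,1,2,\dots$: $$i_t=\nabla f(x_t)-g_{t-1},\quad \tilde i_t=\mathcal{Q}_{b,R_t}(i_t),\quad g_t=g_{t-1}+\tilde i_t,\quad x_{t+1}=x_t-\alpha g_t,\quad R_{t+1}=\gamma R_t+\alpha L\Vert g_t\Vert.$$ *)

(* Defs.v *)
From HB Require Import structures.
From mathcomp Require Import all_boot all_order all_algebra.
From mathcomp Require Import all_classical all_reals all_analysis.
Set Implicit Arguments.
Unset Strict Implicit.
Unset Printing Implicit Defensive.
Import Order.TTheory GRing.Theory Num.Theory.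
Import numFieldNormedType.Exports.
Local Open Scope classical_set_scope.
Local Open Scope ring_scope.

(* The library norm `|x| on 'rV[R]_d is the sup norm, so the Euclidean inner
   product and norm are defined here.  Both norms induce the same topology, so
   the library's [differentiable] and [continuous] are the usual notions. *)
Definition dot (R : realType) (d : nat) (u v : 'rV[R]_d) : R :=
  \sum_(i < d) u 0 i * v 0 i.

Definition enorm (R : realType) (d : nat) (u : 'rV[R]_d) : R :=
  Num.sqrt (\sum_(i < d) u 0 i ^+ 2).

Definition gradient (R : realType) (d : nat) (f : 'rV[R]_d -> R)
    (x : 'rV[R]_d) : 'rV[R]_d :=
  \row_(i < d) 'D_(delta_mx 0 i) f x.

Definition L_smooth (R : realType) (d : nat) (L : R) (f : 'rV[R]_d -> R) : Prop :=
  [/\ forall x, differentiable f x,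
      continuous (gradient f)
    & forall x y, enorm (gradient f x - gradient f y) <= L * enorm (x - y)].

Definition strongly_convex (R : realType) (d : nat) (mu : R)
    (f : 'rV[R]_d -> R) : Prop :=
  (forall x, differentiable f x) /\
  (forall x y, f y - f x >=
     dot (y - x) (gradient f x) + mu / 2 * enorm (y - x) ^+ 2).

Definition unique_minimizer (R : realType) (d : nat) (f : 'rV[R]_d -> R)
    (xs : 'rV[R]_d) : Prop :=
  forall y, y != xs -> f xs < f y.

(* Left end point of the [k]-th of the [2 ^ b] equal bins of [-r, r]. *)
Definition bin_left (R : realType) (b : nat) (r : R) (k : nat) : R :=
  - r + k%:R * (2 * r / 2 ^+ b).

Definition bin_center (R : realType) (b : nat) (r : R) (k : nat) : R :=
  (bin_left b r k + bin_left b r k.+1) / 2.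

(* [beta] assigns to each point of [-r, r] the index of its bin: the fibres of
   [beta] partition [-r, r], and each one is a bin up to its end points.  A
   common end point of two bins may go to either, so that every convention
   (e.g. half-open bins) is allowed, and [r = 0] is not a special case. *)
Definition binning (R : realType) (b : nat) (r : R) (beta : R -> 'I_(2 ^ b)) : Prop :=
  forall x, - r <= x <= r ->
    bin_left b r (beta x) <= x <= bin_left b r (beta x).+1.

(* Nothing is required of [Q X] when [enorm X > r]. *)
Definition is_quantizer (R : realType) (d b : nat) (r : R)
    (Q : 'rV[R]_d -> 'rV[R]_d) : Prop :=
  exists2 beta : R -> 'I_(2 ^ b), binning r beta &
    forall X, enorm X <= r ->
      Q X = \row_(i < d) bin_center b r (beta (X 0 i)).

(* State of AQGD at the start of iteration [t]: the triple [(x_t, g_{t-1}, R_t)].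
   [Q b r] is the quantizer of bit-precision [b] and range [r], and [gf] the
   gradient of the objective. *)
Definition aqgd_state (R : realType) (d : nat) : Type :=
  ('rV[R]_d * 'rV[R]_d * R)%type.

Definition aqgd_step (R : realType) (d : nat)
    (Q : nat -> R -> 'rV[R]_d -> 'rV[R]_d) (gf : 'rV[R]_d -> 'rV[R]_d)
    (L alpha gamma : R) (b : nat) (s : aqgd_state R d) : aqgd_state R d :=
  let: (x, gprev, r) := s in
  let innov := gf x - gprev in
  let g := gprev + Q b r innov in
  (x - alpha *: g, g, gamma * r + alpha * L * enorm g).

Definition aqgd (R : realType) (d : nat)
    (Q : nat -> R -> 'rV[R]_d -> 'rV[R]_d) (gf : 'rV[R]_d -> 'rV[R]_d)
    (L alpha gamma : R) (b : nat) (r0 : R) (t : nat) : aqgd_state R d :=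
  iter t (aqgd_step Q gf L alpha gamma b) (0, 0, r0).

(* The iterate [x_t]. *)
Definition aqgd_x (R : realType) (d : nat)
    (Q : nat -> R -> 'rV[R]_d -> 'rV[R]_d) (gf : 'rV[R]_d -> 'rV[R]_d)
    (L alpha gamma : R) (b : nat) (r0 : R) (t : nat) : 'rV[R]_d :=
  (aqgd Q gf L alpha gamma b r0 t).1.1.

(* Main.v *)
Require Import Defs.
From HB Require Import structures.
From mathcomp Require Import all_boot all_order all_algebra.
From mathcomp Require Import all_classical all_reals all_analysis.
From mathcomp Require Import ring lra.
Import Order.TTheory GRing.Theory Num.Theory.
Import numFieldNormedType.Exports.
Local Open Scope classical_set_scope.
Local Open Scope ring_scope.

(** Write [g] for the gradient estimate updated in a step,
    [e = gradient f x - g] for its quantization error, and [r] for the range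
    before the step.  The potential
    [f x - f xs + alpha * r ^+ 2] contracts by [1 - 1 / (12 * kappa)] at every
    step, and it dominates the suboptimality gap.

    The range bounds the innovation at all times.  Quantization of a vector of
    norm at most [r] errs by at most half a bin in each coordinate, hence by
    [gamma * r] in norm ([quantizer_error]).  The next innovation is [e] plus
    the variation of the gradient over a displacement [alpha *: g], so its norm
    is at most [gamma * r + alpha * L * enorm g], which is exactly the next
    range ([aqgd_step_range]).

    The contraction compares three quadratic quantities.  Expansion of
    [enorm e ^+ 2] in the descent inequality gives a decrease of [alpha / 2] times
    [enorm (gradient f x) ^+ 2 + enorm g ^+ 2 - enorm e ^+ 2], up to a
    curvature term that is a small multiple of [enorm g ^+ 2].  The gradient
    term pays for the contraction of the gap, through the gradient domination
    [gap_le_gradient]; the [enorm g] term absorbs both the curvature and the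
    growth of the range; and [e] together with the rest of the next range costs
    only a multiple of [gamma ^+ 2 * r ^+ 2], which is harmless as soon as
    [gamma ^+ 2 <= 1 / 4] ([aqgd_step_contraction]).

    Smoothness is used through the inequality
    [f y - f x <= dot (y - x) (gradient f x) + L * enorm (y - x) ^+ 2].  Its
    constant is twice the optimal one, but it follows at once from convexity,
    with no integration along the segment, and the step size [1 / (6 * L)]
    leaves enough room for the loss.

    The condition on [b] serves only to obtain [gamma ^+ 2 <= 1 / 4], that is
    [4 * d <= 4 ^ b].  As [kappa / (kappa - 1) >= 1], the choice
    [C = 2 / ln 2] gives [d ^ 2 <= 2 ^ b], which suffices for [d >= 2]; for
    [d = 1], [b >= 1] is enough. *)

(** * Euclidean geometry *)

Lemma dotC {R : realType} {d : nat} (u v : 'rV[R]_d) : dot u v = dot v u.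
Proof. by apply: eq_bigr => i _; rewrite mulrC. Qed.

Lemma dotDl {R : realType} {d : nat} (u v w : 'rV[R]_d) :
  dot (u + v) w = dot u w + dot v w.
Proof. by rewrite /dot -big_split; apply: eq_bigr => i _; rewrite mxE mulrDl. Qed.

Lemma dotZl {R : realType} {d : nat} (a : R) (u w : 'rV[R]_d) :
  dot (a *: u) w = a * dot u w.
Proof. by rewrite /dot mulr_sumr; apply: eq_bigr => i _; rewrite mxE mulrA. Qed.

Lemma dotNl {R : realType} {d : nat} (u w : 'rV[R]_d) : dot (- u) w = - dot u w.
Proof. by rewrite -scaleN1r dotZl mulN1r. Qed.

Lemma dotDr {R : realType} {d : nat} (u v w : 'rV[R]_d) :
  dot w (u + v) = dot w u + dot w v.
Proof. by rewrite dotC dotDl !(dotC w). Qed.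

Lemma dotZr {R : realType} {d : nat} (a : R) (u w : 'rV[R]_d) :
  dot w (a *: u) = a * dot w u.
Proof. by rewrite dotC dotZl (dotC w). Qed.

Lemma dotNr {R : realType} {d : nat} (u w : 'rV[R]_d) : dot w (- u) = - dot w u.
Proof. by rewrite dotC dotNl (dotC w). Qed.

Definition dot_lin := (@dotDl, @dotDr, @dotNl, @dotNr, @dotZl, @dotZr).

Lemma enorm_ge0 {R : realType} {d : nat} (u : 'rV[R]_d) : 0 <= enorm u.
Proof. exact: sqrtr_ge0. Qed.

Lemma sqr_enorm {R : realType} {d : nat} (u : 'rV[R]_d) : enorm u ^+ 2 = dot u u.
Proof.
rewrite /enorm sqr_sqrtr; last by apply: sumr_ge0 => i _; exact: sqr_ge0.
by apply: eq_bigr => i _; rewrite expr2.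
Qed.

Lemma dot_ge0 {R : realType} {d : nat} (u : 'rV[R]_d) : 0 <= dot u u.
Proof. by rewrite -sqr_enorm sqr_ge0. Qed.

Lemma enormN {R : realType} {d : nat} (u : 'rV[R]_d) : enorm (- u) = enorm u.
Proof. by congr Num.sqrt; apply: eq_bigr => i _; rewrite mxE sqrrN. Qed.

Lemma enormZ {R : realType} {d : nat} (a : R) (u : 'rV[R]_d) :
  0 <= a -> enorm (a *: u) = a * enorm u.
Proof.
move=> a0; apply/eqP; rewrite -(@eqrXn2 _ 2) ?mulr_ge0 ?enorm_ge0 //.
by rewrite exprMn !sqr_enorm !dot_lin mulrA.
Qed.

Lemma enorm_le {R : realType} {d : nat} (u : 'rV[R]_d) (r : R) :
  0 <= r -> dot u u <= r ^+ 2 -> enorm u <= r.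
Proof. by move=> r0; rewrite -sqr_enorm ler_sqr ?nnegrE ?enorm_ge0. Qed.

Lemma coord_le_enorm {R : realType} {d : nat} (u : 'rV[R]_d) (i : 'I_d) :
  `|u 0 i| <= enorm u.
Proof.
rewrite -ler_sqr ?nnegrE ?normr_ge0 ?enorm_ge0 // sqr_enorm /dot.
rewrite (bigD1 i) //= real_normK ?num_real // -expr2 lerDl.
by apply: sumr_ge0 => j _; rewrite -expr2 sqr_ge0.
Qed.

Lemma enorm_eq0_dot {R : realType} {d : nat} (u v : 'rV[R]_d) :
  enorm u = 0 -> dot u v = 0.
Proof.
move=> u0; apply: big1 => i _; have := coord_le_enorm u i.
by rewrite u0 normr_le0 => /eqP ->; rewrite mul0r.
Qed.

(** Cauchy-Schwarz, from the nonnegativity of the squared norm of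
    [enorm v *: u - enorm u *: v]. *)
Lemma dot_le_enorm {R : realType} {d : nat} (u v : 'rV[R]_d) :
  dot u v <= enorm u * enorm v.
Proof.
have [u0|un0] := eqVneq (enorm u) 0; first by rewrite enorm_eq0_dot // u0 mul0r.
have [v0|vn0] := eqVneq (enorm v) 0.
  by rewrite dotC enorm_eq0_dot // v0 mulr0.
have p0 : 0 < enorm u * enorm v by rewrite mulr_gt0 // lt_def enorm_ge0 ?un0 ?vn0.
have := dot_ge0 (enorm v *: u - enorm u *: v).
rewrite !dot_lin (dotC v u) -!sqr_enorm => H.
rewrite -(ler_pM2l p0); nra.
Qed.

Lemma enormD {R : realType} {d : nat} (u v : 'rV[R]_d) :
  enorm (u + v) <= enorm u + enorm v.
Proof.
apply: enorm_le; first by rewrite addr_ge0 ?enorm_ge0.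
have := dot_le_enorm u v.
rewrite !dot_lin (dotC v u) sqrrD -!sqr_enorm => H; lra.
Qed.

(** * Smooth and strongly convex functions *)

(** Convexity at [y] bounds [f y - f x] by [dot (y - x) (gradient f y)], and
    replacing [gradient f y] with [gradient f x] costs at most
    [L * enorm (y - x) ^+ 2] by Cauchy-Schwarz. *)
Lemma smooth_convex_descent {R : realType} {d : nat} {f : 'rV[R]_d -> R}
    {L mu : R} (x y : 'rV[R]_d) :
  0 <= mu -> L_smooth L f -> strongly_convex mu f ->
  f y - f x <= dot (y - x) (gradient f x) + L * enorm (y - x) ^+ 2.
Proof.
move=> mu0 [_ _ fL] [_ fmu].
have := fmu y x; have := fL y x.
have := dot_le_enorm (y - x) (gradient f y - gradient f x).
have := enorm_ge0 (y - x).
have : 0 <= mu / 2 * enorm (x - y) ^+ 2.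
  by rewrite mulr_ge0 ?sqr_ge0 // divr_ge0.
rewrite -(opprB y x) dotNl [dot _ (gradient f y - _)]dotDr dotNr.
move: (enorm _) (enorm _) (enorm _) => a n m; move=> *; nra.
Qed.

(** Minimize over [z] the lower bound that strong convexity at [x] gives for
    [f z]: the minimum is at [z - x = - mu^-1 *: gradient f x]. *)
Lemma gap_le_gradient {R : realType} {d : nat} {f : 'rV[R]_d -> R} {mu : R}
    (x z : 'rV[R]_d) :
  0 < mu -> strongly_convex mu f ->
  2 * mu * (f x - f z) <= enorm (gradient f x) ^+ 2.
Proof.
move=> mu0 [_ fmu]; have := fmu x z.
have := dot_ge0 (mu *: (z - x) + gradient f x).
rewrite !sqr_enorm; move: (z - x) => h.
rewrite !dot_lin (dotC _ h) => H1 H2; nra.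
Qed.

(** * The quantizer *)

Lemma bin_center_error {R : realType} (b : nat) (r x : R) (k : nat) :
  bin_left b r k <= x <= bin_left b r k.+1 ->
  `|bin_center b r k - x| <= r / 2 ^+ b.
Proof.
rewrite /bin_center /bin_left -(natr1 k) -mulrA; set h := r / _.
rewrite [(k%:R + 1) * _]mulrDl; move: (k%:R * _) => y /andP[H1 H2].
by rewrite ler_norml; apply/andP; split; lra.
Qed.

Lemma quantizer_error {R : realType} {d b : nat} {r : R}
    {Q : 'rV[R]_d -> 'rV[R]_d} (X : 'rV[R]_d) :
  is_quantizer b r Q -> enorm X <= r ->
  enorm (Q X - X) <= Num.sqrt d%:R / 2 ^+ b * r.
Proof.
case=> beta Hbeta HQ Xr; have r0 := le_trans (enorm_ge0 X) Xr.
have w0 : 0 <= r / 2 ^+ b by rewrite divr_ge0 ?exprn_ge0.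
apply: enorm_le; first by rewrite mulr_ge0 // divr_ge0 ?exprn_ge0 ?sqrtr_ge0.
have -> : (Num.sqrt d%:R / 2 ^+ b * r) ^+ 2 = \sum_(i < d) (r / 2 ^+ b) ^+ 2.
  rewrite sumr_const card_ord -[RHS]mulr_natl [LHS]exprMn expr_div_n.
  by rewrite sqr_sqrtr ?ler0n // expr_div_n mulrAC -mulrA.
apply: ler_sum => i _; rewrite HQ // !mxE -expr2 -real_normK ?num_real //.
rewrite ler_sqr ?nnegrE ?normr_ge0 //; apply: bin_center_error; apply: Hbeta.
by rewrite -ler_norml (le_trans (coord_le_enorm X i)).
Qed.

(** The factor [C = 2 / ln 2] turns the hypothesis into [d ^ 2 <= 2 ^ b], hence
    [4 * d <= d ^ 4 <= 4 ^ b] when [d >= 2]. *)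
Lemma contraction_factor_le {R : realType} (d b : nat) (kappa : R) :
  (0 < d)%N -> (0 < b)%N -> 1 < kappa ->
  2 / ln 2 * ln (d%:R * kappa / (kappa - 1)) <= b%:R ->
  (Num.sqrt d%:R / 2 ^+ b) ^+ 2 <= 1 / 4 :> R.
Proof.
move=> d0 b0 k1 Hb.
have p0 n : 0 < 2 ^+ n :> R by rewrite exprn_gt0.
suff H : 4 * d%:R <= (2 ^+ b) ^+ 2 :> R.
  rewrite expr_div_n sqr_sqrtr ?ler0n // ler_pdivrMr ?exprn_gt0 //; lra.
have b1 : 2 <= 2 ^+ b :> R.
  by rewrite -[X in X <= _]expr1 ler_eXn2l // ltr1n.
move: d0; rewrite leq_eqVlt => /orP[/eqP <-|d2]; first by nra.
have {}d2 : 2 <= d%:R :> R by rewrite ler_nat.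
have dpos : 0 < d%:R :> R by lra.
have ln2 : 0 < ln 2 :> R by rewrite ln_gt0 // ltr1n.
suff Hd : d%:R ^+ 2 <= 2 ^+ b :> R.
  have : (d%:R ^+ 2) ^+ 2 <= (2 ^+ b) ^+ 2 :> R.
    by rewrite ler_sqr ?nnegrE ?sqr_ge0 // ltW.
  apply: le_trans.
  have : 2 * d%:R <= d%:R ^+ 2 :> R
    by rewrite expr2 ler_wpM2r // ltW.
  by move: (d%:R ^+ 2 : R) => D2; nra.
rewrite -ler_ln ?posrE ?exprn_gt0 // !lnXn //.
have lnd : ln (d%:R : R) <= ln (d%:R * kappa / (kappa - 1)).
  have k0 : 0 < kappa - 1 by lra.
  rewrite ler_ln ?posrE //; last by rewrite divr_gt0 // mulr_gt0 //; lra.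
  by rewrite ler_pdivlMr //; nra.
move: Hb; rewrite mulrAC ler_pdivrMr // -[ln 2 *+ b]mulr_natl => Hb; lra.
Qed.

(** * One step of the algorithm *)

Section Step.
Context {R : realType} {d : nat}.
Variables (f : 'rV[R]_d -> R) (L mu : R) (b : nat).
Variable Q : nat -> R -> 'rV[R]_d -> 'rV[R]_d.
Hypotheses (L0 : 0 < L) (mu0 : 0 < mu) (muL : mu < L).
Hypotheses (fL : L_smooth L f) (fmu : strongly_convex mu f).
Hypothesis HQ : forall r, 0 <= r -> is_quantizer b r (Q b r).

Let alpha := 1 / (6 * L).
Let gamma := Num.sqrt d%:R / 2 ^+ b : R.
Let step := aqgd_step Q (gradient f) L alpha gamma b.

Definition range_bounds_innovation (s : aqgd_state R d) : Prop :=
  enorm (gradient f s.1.1 - s.1.2) <= s.2.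

Definition potential (xs : 'rV[R]_d) (s : aqgd_state R d) : R :=
  f s.1.1 - f xs + alpha * s.2 ^+ 2.

Let alpha0 : 0 < alpha. Proof. by rewrite divr_gt0 // mulr_gt0. Qed.

Let gradient_error (s : aqgd_state R d) : range_bounds_innovation s ->
  enorm (gradient f s.1.1 - (step s).1.2) <= gamma * s.2.
Proof.
case: s => [[x g] r] /= Hs; have r0 := le_trans (enorm_ge0 _) Hs.
by rewrite -enormN opprB addrAC -opprB addrC quantizer_error //; exact: HQ.
Qed.

Lemma aqgd_step_range (s : aqgd_state R d) :
  range_bounds_innovation s -> range_bounds_innovation (step s).
Proof.
move=> Hs; have := gradient_error _ Hs; rewrite /range_bounds_innovation.
case: s {Hs} => [[x g] r] /=; move: (g + _) => g' He.
rewrite -(subrKA (gradient f x)) addrC.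
apply: le_trans (enormD _ _) _; apply: lerD => //.
have [_ _ fLip] := fL; apply: le_trans (fLip _ _) _.
by rewrite addrAC subrr add0r enormN enormZ ?(ltW alpha0) // mulrCA mulrA.
Qed.

(** With [A], [B], [E], [P], [S] the values of [enorm (gradient f x) ^+ 2],
    [enorm g' ^+ 2], [enorm e ^+ 2], [gamma ^+ 2 * r ^+ 2] and [r ^+ 2] scaled
    by [alpha], the new potential is at most the gap minus
    [A / 2 + (1 / 2 - 1 / 6 - 1 / 18) * B], plus [E / 2 + 2 * P], where
    [E <= P <= S / 4]. *)
Lemma aqgd_step_contraction (xs : 'rV[R]_d) (s : aqgd_state R d) :
  f xs <= f s.1.1 -> gamma ^+ 2 <= 1 / 4 -> range_bounds_innovation s ->
  potential xs (step s) <= (1 - 1 / (12 * (L / mu))) * potential xs s.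
Proof.
move=> gap gamma_small Hs; have := gradient_error _ Hs.
have r0 := le_trans (enorm_ge0 _) Hs.
rewrite /potential; move: gap r0.
case: s {Hs} => [[x g] r] /=; move: (g + _) => g' gap r0 He.
have alphaL : alpha * L = 1 / 6 by rewrite /alpha; field; rewrite gt_eqF.
have g0 : 0 <= gamma by rewrite divr_ge0 ?sqrtr_ge0 ?exprn_ge0.
have E_le : alpha * enorm (gradient f x - g') ^+ 2 <= alpha * (gamma * r) ^+ 2.
  by rewrite ler_pM2l // ler_sqr ?nnegrE ?enorm_ge0 // mulr_ge0.
have E_eq : enorm (gradient f x - g') ^+ 2 =
    enorm (gradient f x) ^+ 2 + enorm g' ^+ 2 - 2 * dot g' (gradient f x).
  by rewrite !sqr_enorm !dot_lin (dotC (gradient f x)); ring.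
have descent := smooth_convex_descent x (x - alpha *: g') (ltW mu0) fL fmu.
rewrite addrAC subrr add0r dotNl dotZl enormN enormZ ?(ltW alpha0) // in descent.
have curvature : L * (alpha * enorm g') ^+ 2 = alpha * enorm g' ^+ 2 / 6.
  have -> : L * (alpha * enorm g') ^+ 2 = alpha * L * (alpha * enorm g' ^+ 2).
    by rewrite exprMn expr2 -mulrA mulrCA mulrA.
  by rewrite alphaL mulrC mul1r.
have next_range : alpha * (gamma * r + alpha * L * enorm g') ^+ 2 <=
    2 * (alpha * (gamma * r) ^+ 2) + alpha * enorm g' ^+ 2 / 18.
  have := mulr_ge0 (ltW alpha0) (sqr_ge0 (gamma * r - 1 / 6 * enorm g')).
  by rewrite alphaL; lra.
have P_le : alpha * (gamma * r) ^+ 2 <= alpha * r ^+ 2 / 4.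
  rewrite -mulrA ler_pM2l // exprMn.
  have := ler_wpM2r (sqr_ge0 r) gamma_small; lra.
set q := mu / L.
have q0 : 0 < q by rewrite divr_gt0.
have q1 : q < 1 by rewrite ltr_pdivrMr // mul1r.
have -> : 1 / (12 * (L / mu)) = q / 12.
  by rewrite /q; field; rewrite !gt_eqF.
have A_ge : q / 3 * (f x - f xs) <= alpha * enorm (gradient f x) ^+ 2.
  have -> : q / 3 = alpha * (2 * mu).
    by rewrite /q /alpha; field; rewrite gt_eqF.
  by rewrite -mulrA ler_pM2l // gap_le_gradient.
have qgap : 0 <= q * (f x - f xs) by rewrite mulr_ge0 ?subr_ge0 // ltW.
have S0 : 0 <= alpha * r ^+ 2 by rewrite mulr_ge0 ?sqr_ge0 // ltW.
have qS : q * (alpha * r ^+ 2) <= alpha * r ^+ 2.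
  by rewrite ler_piMl // ltW.
have B0 : 0 <= alpha * enorm g' ^+ 2 by rewrite mulr_ge0 ?sqr_ge0 // ltW.
rewrite curvature in descent; rewrite E_eq in E_le.
lra.
Qed.

End Step.

Theorem theorem3p3 (R : realType) :
  exists C : R, 1 <= C /\
  forall (d : nat) (f : 'rV[R]_d -> R) (L mu : R) (xs : 'rV[R]_d)
    (Q : nat -> R -> 'rV[R]_d -> 'rV[R]_d) (b : nat) (r0 : R),
  let kappa := L / mu in
  let alpha := 1 / (6 * L) in
  let gamma := Num.sqrt d%:R / 2 ^+ b in
  let x := aqgd_x Q (gradient f) L alpha gamma b r0 in
  (0 < d)%N -> 0 < L -> 0 < mu ->
  L_smooth L f -> strongly_convex mu f -> unique_minimizer f xs ->
  1 < kappa ->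
  (forall (b' : nat) (r : R), (0 < b')%N -> 0 <= r -> is_quantizer b' r (Q b' r)) ->
  enorm (gradient f 0) <= r0 ->
  (0 < b)%N ->
  C * ln (d%:R * kappa / (kappa - 1)) <= b%:R ->
  forall t : nat,
    f (x t) - f xs
      <= (1 - 1 / (12 * kappa)) ^+ t * (f (x 0%N) - f xs + alpha * r0 ^+ 2).
Proof.
exists (2 / ln 2); split.
  have ln2 : 0 < ln 2 :> R by rewrite ln_gt0 // ltr1n.
  by rewrite ler_pdivlMr // mul1r ltW // ln_sublinear.
move=> d f L mu xs Q b r0 kappa alpha gamma x d0 L0 mu0 fL fmu fmin k1 HQ Hr0 b0.
move=> Hb t.
have muL : mu < L by move: k1; rewrite /kappa ltr_pdivlMr // mul1r.
have gamma_small := contraction_factor_le d b kappa d0 b0 k1 Hb.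
have HQb r : 0 <= r -> is_quantizer b r (Q b r) by exact: HQ.
have fxs y : f xs <= f y.
  by have [->|/fmin/ltW] := eqVneq y xs.
have rho0 : 0 <= 1 - 1 / (12 * kappa).
  rewrite subr_ge0 ler_pdivrMr ?mul1r; lra.
pose s t := aqgd Q (gradient f) L alpha gamma b r0 t.
have [_ Hpot] : range_bounds_innovation f (s t) /\
    potential f L xs (s t) <= (1 - 1 / (12 * kappa)) ^+ t * potential f L xs (s 0%N).
  elim: t => [|t [IHr IHp]].
    by rewrite expr0 mul1r; split=> //; rewrite /range_bounds_innovation /= subr0.
  split; first exact: aqgd_step_range.
  apply: (@le_trans _ _ ((1 - 1 / (12 * kappa)) * potential f L xs (s t))).
    exact: aqgd_step_contraction.
  by rewrite exprS -mulrA ler_wpM2l.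
apply: le_trans Hpot; rewrite lerDl mulr_ge0 ?sqr_ge0 //.
by rewrite divr_ge0 // mulr_ge0 // ltW.
Qed.
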